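(* Let $\mathcal H_M,\mathcal H_R\in\mathbb R^{m\times m}$ be symmetric matrices and let $\mathcal H_R$ be positive definite. Assume that $$\mathcal H_M\boldsymbol v_j=\lambda_j\mathcal H_R\boldsymbol v_j\quad\text{and}\quad\boldsymbol v_j^T\mathcal H_R\boldsymbol v_j=1,\qquad j=1,2,\dots,m,$$ where $\boldsymbol v_1,\dots,\boldsymbol v_m$ are mutually $\mathcal H_R$-orthogonal ($\boldsymbol v_j^T\mathcal H_R\boldsymbol v_k=0$ for $j\ne k$). For some $\delta>0$, define the updates $$\mathcal U_i(\delta)=\delta\,\mathcal H_R\boldsymbol v_i\boldsymbol v_i^T\mathcal H_R,\qquad i=K+1,K+2,\dots,m.$$ Then $(\mathcal H_M+\mathcal U_i(\delta))\boldsymbol v_j=\lambda_j\mathcal H_R\boldsymbol v_j$ for $j\ne i$, and $(\mathcal H_M+\mathcal U_i(\delta))\boldsymbol v_i=(\lambda_i+\delta)\mathcal H_R\boldsymbol v_i$.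
   Context: The generalized eigenvalues of $(\mathcal H_M,\mathcal H_R)$ are ordered as $\lambda_1\ge\lambda_2\ge\dots\ge\lambda_K>-1\ge\lambda_{K+1}\ge\dots\ge\lambda_m$, which defines the index $K$. *)

(* Defs.v *)
From mathcomp Require Import all_boot all_order all_algebra.
From mathcomp Require Import reals.
Set Implicit Arguments.
Unset Strict Implicit.
Unset Printing Implicit Defensive.
Import Order.TTheory GRing.Theory Num.Theory.
Local Open Scope ring_scope.

(* Symmetry is not part of this predicate. *)
Definition posdefmx (R : realType) (m : nat) (A : 'M[R]_m) : Prop :=
  forall x : 'cV[R]_m, x != 0 -> 0 < (x^T *m A *m x) 0 0.

(* Says lambda_1 >= ... >= lambda_K > -1 >= lambda_(K+1) >= ... >= lambda_m.
   As 'I_m is zero-based, the indices 1, ..., K are the j : 'I_m with j < K, and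
   K + 1, ..., m those with K <= j. Both K = 0 and K = m are allowed. *)
Definition ordered_with_index (R : realType) (m : nat)
    (lambda : 'I_m -> R) (K : nat) : Prop :=
  [/\ (K <= m)%N,
      forall j k : 'I_m, (j <= k)%N -> lambda k <= lambda j,
      forall j : 'I_m, (j < K)%N -> -1 < lambda j
    & forall j : 'I_m, (K <= j)%N -> lambda j <= -1].

Definition update (R : realType) (m : nat) (HR : 'M[R]_m)
    (v : 'I_m -> 'cV[R]_m) (i : 'I_m) (delta : R) : 'M[R]_m :=
  delta *: (HR *m v i *m (v i)^T *m HR).

(* Main.v *)
Require Import Defs.
From mathcomp Require Import all_boot all_order all_algebra.
From mathcomp Require Import reals.
Set Implicit Arguments.
Unset Strict Implicit.
Unset Printing Implicit Defensive.
Import Order.TTheory GRing.Theory Num.Theory.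
Local Open Scope ring_scope.

(** The update is a multiple of the outer product of [HR *m v i] with itself ([HR] being symmetric),
    so it sends every [x] to a multiple of [HR *m v i], whose coefficient is [delta] times the
    [HR]-inner product of [v i] and [x]; this is [update_mulmx]. By [HR]-orthonormality it kills
    each [v j] with [j != i] and sends [v i] to [delta *: (HR *m v i)], so only the eigenvalue at
    [i] moves. *)

Lemma update_mulmx (R : realType) (m : nat) (HR : 'M[R]_m)
    (v : 'I_m -> 'cV[R]_m) (i : 'I_m) (delta : R) (x : 'cV[R]_m) :
  update HR v i delta *m x =
    (delta * ((v i)^T *m HR *m x) 0 0) *: (HR *m v i).
Proof.
rewrite /update -scalemxAl -scalerA; congr (_ *: _).
(* Once reassociated, the right factor [(v i)^T *m (HR *m x)] is 1 by 1, hence a scalar matrix that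
   can be pulled out; [[in LHS]] protects its copy under [0 0] on the right. *)
by rewrite -!mulmxA mulmxA [in LHS](mx11_scalar (_^T *m _)) mul_mx_scalar mulmxA.
Qed.

Theorem theorem4p5 (R : realType) (m : nat) (HM HR : 'M[R]_m)
    (lambda : 'I_m -> R) (v : 'I_m -> 'cV[R]_m) (K : nat)
    (HM_sym : HM \is symmetricmx) (HR_sym : HR \is symmetricmx)
    (HR_posdef : posdefmx HR)
    (v_eigen : forall j : 'I_m, HM *m v j = lambda j *: (HR *m v j))
    (v_unit : forall j : 'I_m, ((v j)^T *m HR *m v j) 0 0 = 1)
    (v_orth : forall j k : 'I_m, j != k -> ((v j)^T *m HR *m v k) 0 0 = 0)
    (lambda_ord : ordered_with_index lambda K)
    (delta : R) (delta_gt0 : 0 < delta)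
    (i : 'I_m) (K_le_i : (K <= i)%N) :
  (forall j : 'I_m, j != i ->
     (HM + update HR v i delta) *m v j = lambda j *: (HR *m v j)) /\
  (HM + update HR v i delta) *m v i = (lambda i + delta) *: (HR *m v i).
Proof.
split=> [j ji|]; rewrite mulmxDl v_eigen update_mulmx.
  (* The inner product has [v i] on the left, so orthogonality asks for [i != j], the flip of
     [ji]. *)
  by rewrite v_orth 1?eq_sym // mulr0 scale0r addr0.
by rewrite v_unit mulr1 scalerDl.
Qed.
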